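(* Let $X,Y$ be normed spaces, $q>0$, $F:X\rightrightarrows Y$ a set-valued mapping and $(\bar x,\bar y)\in\mathrm{gph}\,F$. Then $$\mathrm{srg}_q F(\bar x,\bar y)\le \|D_qF(\bar x,\bar y)\|^{\circleddash}_q .$$ If $\dim X<+\infty$ and $\dim Y<+\infty$, then this inequality holds as equality.
   Context: A set-valued mapping $F:X\rightrightarrows Y$ assigns to each $x\in X$ a (possibly empty) subset $F(x)\subset Y$; $\mathrm{gph}\,F=\{(x,y): y\in F(x)\}$. Strong subregularity: $F$ is $q$-order strongly subregular at $(\bar x,\bar y)\in\mathrm{gph}\,F$ with modulus $\tau>0$ if there exist neighbourhoods $U$ of $\bar x$ and $V$ of $\bar y$ such that $\tau\|x-\bar x\|^q\le d(\bar y,F(x)\cap V)$ for all $x\in U$ (with $d(\bar y,\emptyset)=+\infty$). The supremum of all such $\tau>0$ is denoted $\mathrm{srg}_qF(\bar x,\bar y)\in[0,+\infty]$; it equals $0$ if no such $\tau$ exists. The $q$-order graphical derivative $D_qF(\bar x,\bar y):X\rightrightarrows Y$ is defined by: $y\in D_qF(\bar x,\bar y)(x)$ iff there exist $(x_k,y_k)\to(x,y)$ and $t_k\downarrow0$ with $(\bar x+t_kx_k,\bar y+t_k^qy_k)\in\mathrm{gph}\,F$ for all $k\in\mathbb N$. A mapping $H:X\rightrightarrows Y$ is $q$-order positively homogeneous if $0\in H(0)$ and $H(\lambda x)=\lambda^qH(x)$ for all $x\in X$, $\lambda>0$ ($D_qF(\bar x,\bar y)$ is such a mapping). For such $H$,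 $\|H\|^{\circleddash}_q:=\inf_{(x,y)\in\mathrm{gph}\,H\setminus\{(0,0)\}}\|y\|/\|x\|^q\in[0,+\infty]$, with $a/0=+\infty$ for $a>0$ and $\inf\emptyset=+\infty$. *)

(* Defs.v *)
From HB Require Import structures.
From mathcomp Require Import all_boot all_order all_algebra.
From mathcomp Require Import all_classical all_reals all_analysis.

Set Implicit Arguments.
Unset Strict Implicit.
Unset Printing Implicit Defensive.

Import Order.TTheory GRing.Theory Num.Theory.
Import numFieldNormedType.Exports.

Local Open Scope classical_set_scope.
Local Open Scope ring_scope.

Section Definitions.
Context {R : realType}.

Definition finite_dimensional (V : normedModType R) : Prop :=
  exists (n : nat) (e : 'I_n -> V),
    forall v : V, exists c : 'I_n -> R, v = \sum_(i < n) c i *: e i.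

Context {X Y : normedModType R}.
Implicit Types (F H : X -> set Y) (q : R) (x : X) (y : Y).

Definition gph F : set (X * Y) := [set z | F z.1 z.2].

(* In a normed space [edist (y, y')] is the norm of [y - y'], so that
   [edist_inf A y] is the distance from [y] to [A]; it is [+oo] when [A] is
   empty. *)
Definition strongly_subregular_with q F x0 y0 (tau : R) : Prop :=
  0 < tau /\
  exists (U : set X) (V : set Y),
    [/\ nbhs x0 U, nbhs y0 V &
        forall x, U x ->
          ((tau * `|x - x0| `^ q)%:E <= edist_inf (F x `&` V) y0)%E].

(* The maximum with 0 only matters when there is no admissible modulus, since
   the supremum of the empty set is [-oo] in [\bar R]. *)
Definition srg q F x0 y0 : \bar R :=
  maxe 0%E
    (ereal_sup [set tau%:E | tau in strongly_subregular_with q F x0 y0]).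

Definition graphical_derivative q F x0 y0 : X -> set Y :=
  fun x => [set y |
    exists (xs : nat -> X) (ys : nat -> Y) (t : nat -> R),
      [/\ xs @ \oo --> x,
          ys @ \oo --> y,
          forall k, 0 < t k,
          t @ \oo --> (0 : R) &
          forall k, gph F (x0 + t k *: xs k, y0 + t k `^ q *: ys k)]].

(* Meant for [q]-order positively homogeneous [H] with [q > 0]. The division
   is that of [\bar R], for which [0^-1 = +oo]: hence the quotient is [+oo]
   when [x = 0] and [y != 0]. *)
Definition subnorm q H : \bar R :=
  ereal_inf [set (`|z.2|%:E / (`|z.1| `^ q)%:E)%E |
              z in gph H `\ ((0, 0) : X * Y)].

End Definitions.

(* Main.v *)
(* For the inequality, apply subregularity along the sequences defining a point
   of the graph of the derivative, divide by [t^q] and pass to the limit. For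
   equality, if [tau] is not a modulus then graph points violating it, rescaled
   so that the first component has norm 1, stay in a compact set; a cluster
   point bounds the quotient of the derivative from above by [tau]. *)

Require Import Defs.
From HB Require Import structures.
From mathcomp Require Import all_boot all_order all_algebra.
From mathcomp Require Import all_classical all_reals all_analysis.

Set Implicit Arguments.
Unset Strict Implicit.
Unset Printing Implicit Defensive.

Import Order.TTheory GRing.Theory Num.Theory.
Import numFieldNormedType.Exports.

Local Open Scope classical_set_scope.
Local Open Scope ring_scope.

(** * Distance to a set, and continuity of real powers *)

Lemma edist_normE (R : realType) (V : normedModType R) (v w : V) :
  edist (v, w) = `|v - w|%:E.
Proof.
apply/le_anti/andP; split.
  apply/lee_addgt0Pr => e e0; rewrite -EFinD.
  apply: edist_fin => /=; first by rewrite ltr_wpDl.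
  by rewrite -ball_normE /= ltrDl.
apply: le_ereal_inf_tmp => _ [r [r0 +] <-].
by rewrite -ball_normE /= lee_fin => /ltW.
Qed.

Lemma le_edist_infP (R : realType) (V : normedModType R) (A : set V) (v : V)
    (r : R) :
  (r%:E <= edist_inf A v)%E <-> forall w, A w -> r <= `|w - v|.
Proof.
split=> [rA w Aw|rA].
  rewrite -lee_fin distrC -edist_normE; apply: (le_trans rA).
  by apply: ereal_inf_lbound; exists w.
apply: le_ereal_inf_tmp => _ [w Aw <-].
by rewrite edist_normE lee_fin distrC rA.
Qed.

Lemma powR_continuous_pos (R : realType) (q a : R) : 0 < a ->
  {for a, continuous (fun x : R => x `^ q)}.
Proof.
move=> a0; apply: differentiable_continuous; apply/derivable1_diffP.
by case: (is_derive1_powR q a0).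
Qed.

(** * Compactness in finite-dimensional normed spaces *)

Lemma closed_norm_preimage (R : realType) (V : normedModType R) (D : set R) :
  closed D -> closed [set v : V | D `|v|].
Proof. by apply: preimage_closed => v _; exact: norm_continuous. Qed.

(** A spanning family of least size is free: a relation with a nonzero coefficient at [j] would
    allow [e j] to be dropped. *)
Lemma finite_dimensional_free (R : realType) (V : normedModType R) :
  finite_dimensional V -> exists (n : nat) (e : 'I_n -> V),
    (forall v, exists c : 'I_n -> R, v = \sum_(i < n) c i *: e i) /\
    (forall c : 'I_n -> R, \sum_(i < n) c i *: e i = 0 -> forall i, c i = 0).
Proof.
move=> fV.
pose spans n := `[< exists e : 'I_n -> V, forall v : V,
  exists c : 'I_n -> R, v = \sum_(i < n) c i *: e i >].
have ex_n : exists n, spans n.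
  by case: fV => n [e eP]; exists n; apply/asboolP; exists e.
case: (ex_minnP ex_n) => n /asboolP[e eP] n_min.
exists n, e; split=> // c c0 j; apply/eqP; apply: contraT => cj0.
suff /n_min : spans n.-1
  by rewrite leqNgt ltn_predL (leq_ltn_trans _ (ltn_ord j)).
apply/asboolP; exists (fun i => e (lift j i)) => v.
(* Subtracting [d j / c j] times the relation [c0] leaves [v] unchanged and cancels its coefficient
   at [j]. *)
have [d vE] := eP v; exists (fun i => d (lift j i) - d j / c j * c (lift j i)).
have -> : v = \sum_(i < n) (d i - d j / c j * c i) *: e i.
  under eq_bigr do rewrite scalerBl -scalerA.
  by rewrite sumrB -scaler_sumr c0 scaler0 subr0.
by rewrite (bigD1_ord j)//= divfK// subrr scale0r add0r.
Qed.

(* For the combination map [f] of a basis, [`|f c|] attains a positive minimum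
   on the unit sphere of ['rV_n]. *)
Lemma finite_dimensional_coord_bound (R : realType) (V : normedModType R) :
  finite_dimensional V -> exists (n : nat) (f : 'rV[R]_n -> V) (C : R),
    continuous f /\ forall v, exists2 c, v = f c & `|c| <= C * `|v|.
Proof.
move=> /finite_dimensional_free[n [e [e_span e_free]]].
pose f (c : 'rV[R]_n) := \sum_(i < n) c ord0 i *: e i.
have f_cont : continuous f.
  apply: continuous_big; first exact: add_continuous.
  move=> i _ c; apply: cvgZl; last exact: coord_continuous.
  exact: nbhs_filter.
have fZ a c : f (a *: c) = a *: f c.
  by rewrite /f scaler_sumr; apply: eq_bigr => i _; rewrite mxE scalerA.
have f_inj c : f c = 0 -> c = 0.
  by move=> /e_free c0; apply/rowP => i; rewrite c0 mxE.
exists n, f; suff [C CP] : exists C, forall c, `|c| <= C * `|f c|.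
  exists C; split=> // v; have [d ->] := e_span v.
  have -> : \sum_(i < n) d i *: e i = f (\row_i d i).
    by apply: eq_bigr => i _; rewrite mxE.
  by exists (\row_i d i).
pose S := [set c : 'rV[R]_n | `|c| = 1].
have S_normalized c : c != 0 -> S (`|c|^-1 *: c).
  by move=> c0; rewrite /S /= normrZ normfV normr_id mulVf// normr_eq0.
(* If the sphere is empty, every coordinate vector is 0, so any constant works. *)
have [S0|/set0P S0] := eqVneq S set0.
  exists 0 => c; have [->|/S_normalized] := eqVneq c 0; last by rewrite S0.
  by rewrite normr0 mul0r.
have S_compact : compact S.
  apply: bounded_closed_compact.
    by exists 1; split=> // r r1 c /= ->; exact: ltW.
  exact: (closed_norm_preimage (@closed_eq R _)).
have [|c0 /set_mem Sc0 c0_min] :=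
    @compact_EVT_min _ R (fun c => `|f c|) S S0 S_compact.
  apply: continuous_subspaceT => c.
  by apply: continuous_comp; [exact: f_cont|exact: norm_continuous].
have fc0 : 0 < `|f c0|.
  rewrite normr_gt0; apply/eqP => /f_inj c00.
  by move: Sc0; rewrite /S /= c00 normr0 => /esym/eqP; rewrite oner_eq0.
exists `|f c0|^-1 => c; have [->|c_neq0] := eqVneq c 0.
  by rewrite normr0 mulr_ge0// invr_ge0.
have := c0_min _ (mem_set (S_normalized _ c_neq0)).
by rewrite fZ normrZ normfV normr_id ler_pdivlMl ?normr_gt0// mulrC
  ler_pdivlMl.
Qed.

(** Bounded vectors have bounded coordinates, so [A] is a closed subset of the continuous image of a
    compact ball of coordinates. *)
Lemma finite_dimensional_closed_compact (R : realType) (V : normedModType R)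
    (A : set V) (M : R) :
  finite_dimensional V -> closed A -> (forall v, A v -> `|v| <= M) ->
  compact A.
Proof.
move=> /finite_dimensional_coord_bound[n [f [C [f_cont fP]]]] A_closed AM.
(* The sign of [C] is unknown; with [|C|] the radius is monotone in the bound on [|v|]. *)
pose B := [set c : 'rV[R]_n | `|c| <= `|C| * M].
have B_compact : compact B.
  apply: bounded_closed_compact.
    exists (`|C| * M); split=> [|r /ltW r1 c /= /le_trans]; last exact.
    exact: num_real.
  exact: (closed_norm_preimage (@closed_le R _)).
apply: subclosed_compact A_closed
  (continuous_compact (continuous_subspaceT f_cont) B_compact) _.
move=> v Av; have [c vE cC] := fP v; exists c => //.
rewrite /B /=; apply: (le_trans cC).
rewrite (le_trans (ler_wpM2r (normr_ge0 v) (ler_norm C)))//.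
by rewrite ler_wpM2l// AM.
Qed.

(** * The two inequalities for the graphical derivative *)

Section GraphicalDerivative.
Context {R : realType} {X Y : normedModType R}.
Context (q : R) (F : X -> set Y) (x0 : X) (y0 : Y) (q_gt0 : 0 < q).

(** Choosing a point for each [e = 1/(k+1)] yields the required sequences. In this form a cluster
    point can be used directly, with no subsequence to extract. *)
Lemma graphical_derivative_near x y :
  (forall e : R, 0 < e -> exists t x' y',
    [/\ 0 < t < e, `|x - x'| < e, `|y - y'| < e &
        gph F (x0 + t *: x', y0 + t `^ q *: y')]) ->
  graphical_derivative q F x0 y0 x y.
Proof.
move=> near_xy.
have {near_xy} /choice[z zP] : forall k : nat, exists z : R * X * Y,
    [/\ 0 < z.1.1 < k.+1%:R^-1, `|x - z.1.2| < k.+1%:R^-1,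
        `|y - z.2| < k.+1%:R^-1 &
        gph F (x0 + z.1.1 *: z.1.2, y0 + z.1.1 `^ q *: z.2)].
  move=> k; have [|t [x' [y' ?]]] := near_xy k.+1%:R^-1.
    by rewrite invr_gt0.
  by exists (t, x', y').
exists (fun k => (z k).1.2), (fun k => (z k).2), (fun k => (z k).1.1).
have small (e : R) : 0 < e -> \forall k \near \oo, k.+1%:R^-1 < e.
  by move=> e0; exact: (near_infty_natSinv_lt (PosNum e0)).
split.
- apply/cvgrPdist_lt => e /small; apply: filterS => k; apply: lt_trans.
  by case: (zP k).
- apply/cvgrPdist_lt => e /small; apply: filterS => k; apply: lt_trans.
  by case: (zP k).
- by move=> k; case: (zP k) => /andP[].
- apply/cvgrPdist_lt => e /small; apply: filterS => k; apply: lt_trans.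
  by case: (zP k) => /andP[t0 te] _ _ _; rewrite sub0r normrN gtr0_norm.
- by move=> k; case: (zP k).
Qed.

Lemma strongly_subregular_le_graphical_derivative tau x y :
  strongly_subregular_with q F x0 y0 tau ->
  graphical_derivative q F x0 y0 x y -> x != 0 -> tau * `|x| `^ q <= `|y|.
Proof.
move=> [tau0 [U [W [U_nbhs W_nbhs UW]]]].
move=> [xs [ys [t [xs_cvg ys_cvg t_gt0 t_cvg F_xys]]]] x_neq0.
have tq_cvg : t k `^ q @[k --> \oo] --> 0.
  (* The limit of [s ^ q] at 0 is taken from the right, so [t] must be seen as tending to 0 through
     positive values. *)
  apply: (@cvg_comp _ _ _ t (fun s => s `^ q) _ (at_right 0)).
    move=> A A_right; have : \forall k \near \oo, 0 < t k -> A (t k).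
      exact: t_cvg A_right.
    by apply: filterS => k; apply; exact: t_gt0.
  exact: powR_cvg0.
have U_near : \forall k \near \oo, U (x0 + t k *: xs k).
  have : x0 + t k *: xs k @[k --> \oo] --> x0.
    rewrite -[X in _ --> X]addr0 -(scale0r x).
    by apply: cvgD; [exact: cvg_cst|exact: cvgZ].
  exact.
have W_near : \forall k \near \oo, W (y0 + t k `^ q *: ys k).
  have : y0 + t k `^ q *: ys k @[k --> \oo] --> y0.
    rewrite -[X in _ --> X]addr0 -(scale0r y).
    by apply: cvgD; [exact: cvg_cst|exact: cvgZ].
  exact.
have le_near : \forall k \near \oo, tau * `|xs k| `^ q <= `|ys k|.
  near=> k; have Uk : U (x0 + t k *: xs k) by near: k.
  have Wk : W (y0 + t k `^ q *: ys k) by near: k.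
  have tq0 : 0 < t k `^ q by exact: powR_gt0.
  (* Subregularity is tested on the graph point of index [k]; both sides then carry the factor
     [t k ^ q], which cancels. *)
  have /le_edist_infP/(_ _ (conj (F_xys k) Wk)) := UW _ Uk.
  rewrite /= !(addrC _ (_ *: _)) !addrK !normrZ (gtr0_norm (t_gt0 k)).
  by rewrite (gtr0_norm tq0) powRM// ?(ltW (t_gt0 k))// mulrCA ler_pM2l.
apply: ler_cvg_to le_near; last exact: cvg_norm.
apply: cvgM; first exact: cvg_cst.
(* Here [x != 0] matters: continuity of the power is used at [|x| > 0]. *)
apply: (@cvg_comp _ _ _ (fun k => `|xs k|) (fun s => s `^ q) _
  (nbhs `|x|)).
  exact: cvg_norm.
by apply: powR_continuous_pos; rewrite normr_gt0.
Unshelve. all: by end_near. Qed.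

Lemma srg_le_subnorm :
  (srg q F x0 y0 <= subnorm q (graphical_derivative q F x0 y0))%E.
Proof.
apply: le_ereal_inf_tmp => _ [[x y] [/= Dxy xy_neq0] <-] /=.
(* For [x = 0] we have [y != 0] and the quotient is [+oo], since [0 ^ q = 0]. *)
have [x_eq0|x_neq0] := eqVneq x 0.
  have y_neq0 : y != 0 by apply: contra_notN xy_neq0 => /eqP ->; rewrite x_eq0.
  rewrite x_eq0 normr0 powR0 ?gt_eqF// inve0 gt0_muley ?leey//.
  by rewrite lte_fin normr_gt0.
have xq_gt0 : 0 < `|x| `^ q by rewrite powR_gt0// normr_gt0.
rewrite inver gt_eqF// -EFinM ge_max lee_fin divr_ge0 ?(ltW xq_gt0)//=.
apply: ge_ereal_sup => _ [tau tau_reg <-]; rewrite lee_fin ler_pdivlMr//.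
exact: strongly_subregular_le_graphical_derivative.
Qed.

Lemma lt_subnorm_strongly_subregular tau :
  finite_dimensional X -> finite_dimensional Y -> 0 < tau ->
  (tau%:E < subnorm q (graphical_derivative q F x0 y0))%E ->
  strongly_subregular_with q F x0 y0 tau.
Proof.
move=> fX fY tau0 tau_lt; split=> //; apply: contrapT => not_reg.
have /choice[z zP] : forall k : nat, exists z : R * X * Y,
    [/\ 0 < z.1.1 < k.+1%:R^-1, `|z.1.2| = 1, `|z.2| <= tau &
        gph F (x0 + z.1.1 *: z.1.2, y0 + z.1.1 `^ q *: z.2)].
  move=> k; apply: contrapT => no_z; apply: not_reg.
  have k0 : (0 : R) < k.+1%:R^-1 by rewrite invr_gt0.
  (* Only the neighbourhood of [x0] has to shrink: a violation already bounds [|y - y0|] by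
     [tau * |x - x0| ^ q]. *)
  exists (ball x0 k.+1%:R^-1), setT; split; first exact: nbhsx_ballx.
    exact: filterT.
  move=> x; rewrite -ball_normE /= distrC => x_near.
  apply/le_edist_infP => y [Fxy _]; rewrite leNgt; apply/negP => y_lt.
  (* At [x = x0] a violation would read [|y - y0| < 0]. *)
  have t_gt0 : 0 < `|x - x0|.
    rewrite lt_neqAle normr_ge0 andbT eq_sym; apply/negP => /eqP xx0.
    by move: y_lt; rewrite xx0 powR0 ?gt_eqF// mulr0 ltNge normr_ge0.
  have tq_gt0 : 0 < `|x - x0| `^ q by exact: powR_gt0.
  apply: no_z; exists (`|x - x0|, `|x - x0|^-1 *: (x - x0),
    (`|x - x0| `^ q)^-1 *: (y - y0)); split => /=.
  - exact/andP.
  - by rewrite normrZ normfV normr_id mulVf// gt_eqF.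
  - by rewrite normrZ normfV (gtr0_norm tq_gt0) ler_pdivrMl// mulrC ltW.
  - by rewrite !scalerA !divff ?gt_eqF// !scale1r !(addrC _ (_ - _)) !subrK.
pose SX := [set x : X | `|x| = 1]; pose BY := [set y : Y | `|y| <= tau].
have SX_compact : compact SX.
  apply: (finite_dimensional_closed_compact (M := 1)) => //; last first.
    by move=> x ->.
  exact: (closed_norm_preimage (@closed_eq R _)).
have BY_compact : compact BY.
  apply: (finite_dimensional_closed_compact (M := tau)) => //.
  exact: (closed_norm_preimage (@closed_le R _)).
pose xy k := ((z k).1.2, (z k).2).
have xy_in : \forall k \near \oo, (SX `*` BY) (xy k).
  by apply: nearW => k; case: (zP k).
have [[x y] [/= [Sx By] clust]] :=
  @compact_setX _ _ _ _ SX_compact BY_compact (xy @ \oo) _ xy_in.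
have Dxy : graphical_derivative q F x0 y0 x y.
  apply: graphical_derivative_near => e e0.
  (* The cluster point is tested against a tail of the sequence, so that the index found also
     satisfies [1/(k+1) < e], which makes the step size less than [e]. *)
  have tail_xy : (xy @ \oo) (xy @` [set k | k.+1%:R^-1 < e]).
    have : \forall k \near \oo, (xy @` [set k | k.+1%:R^-1 < e]) (xy k).
      have := near_infty_natSinv_lt (PosNum e0).
      by apply: filterS => k ke; exists k.
    exact.
  have ball_xy : nbhs (x, y) (ball x e `*` ball y e).
    by exists (ball x e, ball y e) => //; split; exact: nbhsx_ballx.
  have [_ [[k /= ke <-] /= [xe ye]]] := clust _ _ tail_xy ball_xy.
  have [/andP[t0 tk] _ _ Fz] := zP k.
  move: xe ye; rewrite -!ball_normE /= => xe ye.
  exists (z k).1.1, (z k).1.2, (z k).2; split=> //.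
  by rewrite t0 (lt_trans tk).
(* As [|x| = 1], the quotient at [(x, y)] is [|y| <= tau], against the strict bound on [subnorm]. *)
have : (tau%:E < `|y|%:E / (`|x| `^ q)%:E)%E.
  apply: (lt_le_trans tau_lt); apply: ereal_inf_lbound.
  exists (x, y) => //; split=> //= -[x_eq0 _].
  by move: Sx; rewrite x_eq0 /SX /= normr0 => /esym/eqP; rewrite oner_eq0.
by rewrite Sx powR1 inve1 mule1 lte_fin ltNge => /negP; apply.
Qed.

(** A real [tau] strictly between [srg] and [subnorm] would be a modulus exceeding the supremum.
    Since [srg >= 0], such a [tau] is positive. *)
Lemma subnorm_le_srg : finite_dimensional X -> finite_dimensional Y ->
  (subnorm q (graphical_derivative q F x0 y0) <= srg q F x0 y0)%E.
Proof.
move=> fX fY; rewrite leNgt; apply/negP.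
have : (0 <= srg q F x0 y0)%E by rewrite le_max lexx.
have srg_ge tau : 0 < tau ->
    (tau%:E < subnorm q (graphical_derivative q F x0 y0))%E ->
    (tau%:E <= srg q F x0 y0)%E.
  move=> tau0 tau_lt; rewrite le_max; apply/orP; right.
  apply: ereal_sup_ubound; exists tau => //.
  exact: lt_subnorm_strongly_subregular.
case: (srg q F x0 y0) srg_ge => [s srg_ge|_ _|//]; last by rewrite ltNge leey.
rewrite lee_fin => s0; case: (subnorm _ _) srg_ge => [r| |//] srg_ge.
  rewrite lte_fin => sr.
  (* For finite [subnorm] the midpoint serves as [tau]; for [+oo], [s + 1] does. *)
  have m0 : 0 < (s + r) / 2.
    by rewrite divr_gt0// ltr_wpDl// (le_lt_trans s0).
  by have := srg_ge _ m0; rewrite lte_fin lee_fin leNgt !midf_lt// => /(_ isT).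
have s1 : 0 < s + 1 by rewrite ltr_wpDl.
by move=> _; have := srg_ge _ s1; rewrite ltry lee_fin gerDl ler10 => /(_ isT).
Qed.

End GraphicalDerivative.

Theorem proposition3p4 (R : realType) (X Y : normedModType R) (q : R)
    (F : X -> set Y) (x0 : X) (y0 : Y) :
  0 < q ->
  gph F (x0, y0) ->
  (srg q F x0 y0 <= subnorm q (graphical_derivative q F x0 y0))%E /\
  (finite_dimensional X -> finite_dimensional Y ->
   srg q F x0 y0 = subnorm q (graphical_derivative q F x0 y0)).
Proof.
move=> q_gt0 _; split; first exact: srg_le_subnorm.
move=> fX fY; apply/le_anti/andP; split; first exact: srg_le_subnorm.
exact: subnorm_le_srg.
Qed.
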